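(* Let $G$ be a tree with $n\geq 1$ vertices. In the blind variant of the optimal stopping problem on $G$, an optimal algorithm is to stop after $l$ vertices where $l=\lfloor\frac{n+1}{2}\rfloor$ or $l=\lceil\frac{n+1}{2}\rceil$ (i.e. each of these two values of $l$ maximizes the expected number $CC[l]$ of connected components among all $l\in\{0,1,\dots,n\}$). Moreover, the maximum expected number of connected components over blind algorithms satisfies $$\frac{1}{4}n<\max_{\mathcal{A}}CC(\mathcal{A})<\frac{1}{4}n+1.$$
   Context: Let $G$ be a fixed graph with $n$ vertices. Its vertices become active one by one in a uniformly random order (permutation) $\sigma\in S_n$; $\sigma(i)$ denotes the $i$-th vertex to become active. $CC(\sigma,t)$ denotes the number of connected components of the induced subgraph $G[\{\sigma(1),\dots,\sigma(t)\}]$. A stopping algorithm $\mathcal{A}$ assigns to each $\sigma$ a stopping time $\mathcal{A}(\sigma)\in\{0,1,\dots,n\}$, and its score is $CC(\mathcal{A})=\frac{1}{n!}\sum_{\sigma\in S_n}CC(\sigma,\mathcal{A}(\sigma))$. Blind variant: the algorithm knows $G$ in advance, but during the game it knows only the number of vertices that have become active. Thus a blind algorithm stops at a fixed time $l\in\{0,\dots,n\}$ independent of $\sigma$, and its score is $CC[l]=\frac{1}{n!}\sum_{\sigma\in S_n}CC(\sigma,l)$. An optimal algorithm is one maximizing $CC(\mathcal{A})$ among blind algorithms. *)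

(* Defs.v *)
From mathcomp Require Import all_boot all_order all_fingroup all_algebra.

Set Implicit Arguments.
Unset Strict Implicit.
Unset Printing Implicit Defensive.

Import Order.TTheory GRing.Theory Num.Theory.

Definition simple_graph n (e : rel 'I_n) : Prop := symmetric e /\ irreflexive e.

Definition connected_graph n (e : rel 'I_n) : Prop := forall x y, connect e x y.

(* Cycles have length at least 3: an edge traversed back and forth is not one. *)
Definition acyclic n (e : rel 'I_n) : Prop :=
  forall c : seq 'I_n, 2 < size c -> ~ ucycle e c.

Definition is_tree n (e : rel 'I_n) : Prop :=
  [/\ simple_graph e, connected_graph e & acyclic e].

Definition induced n (e : rel 'I_n) (A : {set 'I_n}) : rel 'I_n :=
  [rel x y | [&& x \in A, y \in A & e x y]].

(* Positions are 0-based: s i is the (i+1)-st vertex to become active. *)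
Definition active n (s : 'S_n) (t : nat) : {set 'I_n} :=
  [set s i | i : 'I_n & i < t].

Definition CC n (e : rel 'I_n) (s : 'S_n) (t : nat) : nat :=
  n_comp (induced e (active s t)) (active s t).

Definition stopping_algorithm n := {ffun 'S_n -> 'I_n.+1}.

Definition score n (e : rel 'I_n) (A : stopping_algorithm n) : rat :=
  ((\sum_(s : 'S_n) (CC e s (A s))%:R) / (n`!)%:R)%R.

Definition stop_at n (l : 'I_n.+1) : stopping_algorithm n := [ffun=> l].

Definition blind n (A : stopping_algorithm n) : bool :=
  [exists l, A == stop_at l].

Definition optimal_blind n (e : rel 'I_n) (A : stopping_algorithm n) : Prop :=
  blind A /\ (forall B, blind B -> (score e B <= score e A)%R).

(* The default value of the iterated maximum is itself the score of a blind
   algorithm, so it does not affect the maximum. *)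
Definition max_blind n (e : rel 'I_n) : rat :=
  \big[Num.max/score e (stop_at ord0)]_(A : stopping_algorithm n | blind A)
    score e A.

(* Main.v *)
(** Root the tree at [r].  By acyclicity every edge joins a vertex to its
    parent, so each component of an induced subgraph has exactly one vertex that
    is the root or whose parent is inactive; hence the number of components is
    the number of active vertices minus the number of active pairs
    (vertex, parent).  By double transitivity of the symmetric group, each of
    the [n - 1] such pairs is active at time [l] with the same probability
    [l (l - 1) / (n (n - 1))], so [CC[l] = l (n + 1 - l) / n]. *)
Require Import Defs.
From mathcomp Require Import all_boot all_order all_fingroup all_algebra.
From mathcomp Require Import zify ring.

Set Implicit Arguments.
Unset Strict Implicit.
Unset Printing Implicit Defensive.

Import Order.TTheory GRing.Theory Num.Theory.

(** * Rooting a tree: parents and edges *)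

Lemma parent_exists (T : finType) (e : rel T) (r : T) :
    (forall x, connect e x r) ->
  exists p : T -> T, exists d : T -> nat,
    forall x, x != r -> e x (p x) && (d (p x) < d x).
Proof.
move=> er.
have ex x : exists k, [exists t : k.-tuple T, path e x t && (last x t == r)].
  have /connectP[t pt lt] := er x; exists (size t).
  by apply/existsP; exists (in_tuple t); rewrite /= pt -lt eqxx.
(* [d x] is the distance from [x] to [r]. The second vertex of a shortest path to [r] is strictly
   closer, so for [x != r] the [pick] below succeeds and the default [x] is never taken. *)
pose d x := ex_minn (ex x).
have dle x t : path e x t -> last x t = r -> d x <= size t.
  move=> pt lt; rewrite /d; case: ex_minnP => m _; apply.
  by apply/existsP; exists (in_tuple t); rewrite /= pt lt eqxx.
exists (fun x => odflt x [pick y | e x y && (d y < d x)]), d => x xr.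
case: pickP => //= none.
have: exists2 t : seq T, path e x t /\ last x t = r & size t = d x.
  rewrite /d; case: ex_minnP => m /existsP[t /andP[pt /eqP lt]] _.
  by exists t; rewrite ?size_tuple.
case=> -[|y t] [/= pt lt] sz; first by rewrite lt eqxx in xr.
case/andP: pt => exy pt; have := none y.
by rewrite exy -sz ltnS dle.
Qed.

(** A path from [x] to [y] avoiding the edge, once made repetition-free, would close up with that
    edge into a cycle. *)
Lemma acyclic_bridge n (e : rel 'I_n) (x y : 'I_n) :
    simple_graph e -> acyclic e -> e x y ->
  ~~ connect [rel u v | e u v && ~~ ((u == x) && (v == y)
                                     || (u == y) && (v == x))] x y.
Proof.
move=> [sym irr] acyc exy; apply/negP => /connectP[t0 pt0 lt0].
case: (shortenP pt0) lt0 => t pt ut _ yt.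
have subp u s : path [rel u v | e u v && ~~ ((u == x) && (v == y)
                   || (u == y) && (v == x))] u s -> path e u s.
  by apply: sub_path => ? ? /= /andP[].
apply: (acyc (x :: t)); last first.
  rewrite /ucycle ut andbT /= rcons_path (subp _ _ pt) /= -yt.
  by rewrite sym.
(* The cycle [x :: t] has length at least 3: an empty [t] makes the edge a loop, and a single step
   from [x] to [y] is the deleted edge. *)
case: t => [|z [|w t]] //= in pt ut yt *.
  by rewrite yt irr in exy.
by move: pt; rewrite -yt !eqxx /= !andbF.
Qed.

(** If neither end were the parent of the other, climbing parents from both ends to [r] would never
    use the edge, so its ends would stay connected without it, although it is a bridge. *)
Lemma edge_parent n (e : rel 'I_n) (r : 'I_n) (p : 'I_n -> 'I_n)
    (d : 'I_n -> nat) :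
    simple_graph e -> acyclic e ->
    (forall x, x != r -> e x (p x) && (d (p x) < d x)) ->
  forall x y, e x y -> (x != r) && (p x == y) || (y != r) && (p y == x).
Proof.
move=> sg acyc pP x y exy; apply/negPn/negP => /norP[nx ny].
have /negP[] := acyclic_bridge sg acyc exy.
set e' := [rel u v | _].
have sym' : symmetric e'.
  move=> u v; rewrite /= sg.1; congr (_ && ~~ _).
  by rewrite orbC; congr (_ || _); rewrite andbC.
have toroot u : connect e' u r.
  have [k] := ubnP (d u); elim: k u => // k IH u.
  rewrite ltnS => du; have [->|ur] := eqVneq u r; first exact: connect0.
  have /andP[eu dpu] := pP u ur.
  apply: (connect_trans (y := p u)); last exact/IH/(leq_trans dpu).
  apply: connect1; rewrite /= eu /=; apply/norP; split; apply/andP.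
    by case=> /eqP ux /eqP py; rewrite -ux ur py eqxx in nx.
  by case=> /eqP uy /eqP px; rewrite -uy ur px eqxx in ny.
apply: (connect_trans (toroot x)).
by rewrite (sym_connect_sym sym').
Qed.

(** * Components of an induced subgraph of a rooted tree *)

Lemma n_comp_induced n (e : rel 'I_n) (r : 'I_n) (p : 'I_n -> 'I_n)
    (d : 'I_n -> nat) (A : {set 'I_n}) :
    simple_graph e -> acyclic e ->
    (forall x, x != r -> e x (p x) && (d (p x) < d x)) ->
  n_comp (induced e A) A
    + #|[set x in A | (x != r) && (p x \in A)]| = #|A|.
Proof.
move=> sg acyc pP; have [sym irr] := sg.
(* [f] climbs to the parent as long as both vertices are in [A]; [top x] is the highest vertex
   reached, a canonical representative of the component of [x]. *)
pose f x := if [&& x \in A, x != r & p x \in A] then p x else x.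
pose top x := iter (\max_y d y) f x.
have f_lt x : (f x == x) || (d (f x) < d x).
  rewrite /f; case: ifP => [/and3P[_ xr _]|_]; last by rewrite eqxx.
  by have /andP[_ ->] := pP x xr; rewrite orbT.
have f_top x : f (top x) = top x.
  (* Each step that moves lowers [d], so after as many steps as the maximum of [d] no further move
     is possible. *)
  have H k : (f (iter k f x) == iter k f x) || (d (iter k f x) + k <= d x).
    elim: k => [|k /= /orP[/eqP E|IH]]; first by rewrite /= addn0 leqnn orbT.
      by rewrite !E eqxx.
    have /orP[/eqP E|lt] := f_lt (iter k f x); first by rewrite !E eqxx.
    by apply/orP; right; rewrite addnS; apply: leq_trans IH; rewrite ltn_add2r.
  have /orP[/eqP//|le] := H (\max_y d y).
  have /orP[/eqP//|lt] := f_lt (top x).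
  have : d x <= \max_y d y by apply: leq_bigmax.
  by rewrite /top in lt *; lia.
have top_f x : top (f x) = top x by rewrite -[RHS]f_top /top -iterSr.
have fA x : x \in A -> f x \in A.
  by rewrite /f; case: ifP => // /and3P[].
have symA : symmetric (induced e A).
  by move=> x y; rewrite /induced /= andbCA sym.
have csym := sym_connect_sym symA.
have conn_f x : connect (induced e A) x (f x).
  rewrite /f; case: ifP => [/and3P[xA xr pA]|_]; last exact: connect0.
  by apply: connect1; rewrite /induced /= xA pA; case/andP: (pP x xr).
have conn_top x : connect (induced e A) x (top x).
  rewrite /top; elim: (\max_y d y) => [|k IH] /=; first exact: connect0.
  exact: connect_trans IH (conn_f _).
have topA x : x \in A -> top x \in A.
  by move=> xA; rewrite /top; elim: (\max_y d y) => //= k; apply: fA.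
have top_edge x y : induced e A x y -> top x = top y.
  case/and3P=> xA yA exy.
  have /orP[/andP[xr /eqP pxy]|/andP[yr /eqP pyx]] :=
    edge_parent sg acyc pP exy.
    by rewrite -top_f /f xA xr pxy yA.
  by rewrite -[RHS]top_f /f yA yr pyx xA.
have top_conn x y : connect (induced e A) x y -> top x = top y.
  case/connectP=> t; elim: t x => [|z t IH] x /=; first by move=> _ ->.
  by case/andP=> xz pt lt; rewrite (top_edge _ _ xz); apply: IH.
have clA : closed (induced e A) (mem A).
  by move=> x y /and3P[xA yA _]; rewrite xA yA.
pose B := [set x in A | f x == x].
have top_fix x : f x = x -> top x = x.
  by move=> fx; rewrite /top; elim: (\max_y d y) => //= k ->.
(* [rt] maps [B] bijectively onto the roots chosen by [fingraph]: [top] is constant on components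
   and fixes [B], and each such root is the image of its own [top]. *)
have BE : n_comp (induced e A) A = #|B|.
  pose rt := fingraph.root (induced e A).
  rewrite -(card_in_imset (f := rt) (D := mem B)); last first.
    move=> x y; rewrite !inE => /andP[_ /eqP fx] /andP[_ /eqP fy] /eqP.
    by rewrite root_connect // => /top_conn; rewrite !top_fix.
  apply: eq_card => x; rewrite !inE; apply/andP/imsetP => [[rx xA]|].
    exists (top x); first by rewrite inE topA //= f_top.
    by rewrite -[LHS](eqP rx); apply/eqP; rewrite root_connect.
  case=> y; rewrite inE => /andP[yA _] ->.
  split; first exact: fingraph.roots_root.
  by rewrite -(closed_connect clA (connect_root _ y)).
have -> : [set x in A | (x != r) && (p x \in A)] = A :\: B.
  apply/setP=> x; rewrite !inE; case: (boolP (x \in A)) => xA //=.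
    rewrite andbT /f xA /=; case: ifP => [/andP[xr _]|_]; last by rewrite eqxx.
    apply/esym/eqP => E; have /andP[_] := pP x xr; by rewrite E ltnn.
have BA : B \subset A by apply/subsetP => x; rewrite inE => /andP[].
by rewrite BE cardsD (setIidPr BA) subnKC // subset_leq_card.
Qed.

(** * Counting orders in which given vertices are active *)

Lemma mem_active n (s : 'S_n) t x : (x \in active s t) = ((s^-1)%g x < t).
Proof.
apply/imsetP/idP => [[i + ->]|lt]; first by rewrite inE permK.
by exists ((s^-1)%g x); rewrite ?inE ?permKV.
Qed.

Lemma card_ord_lt n l : l <= n -> #|[pred i : 'I_n | i < l]| = l.
Proof.
move=> ln; rewrite -sum1_card (big_ord_narrow ln) /=.
by rewrite sum_nat_const card_ord muln1.
Qed.

Lemma card_active n (s : 'S_n) l : l <= n -> #|active s l| = l.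
Proof.
by move=> ln; rewrite card_imset ?cardsE ?card_ord_lt //; apply: perm_inj.
Qed.

Lemma perm_2transitive (T : finType) (x y x' y' : T) :
  x != y -> x' != y' -> exists q : {perm T}, q x = x' /\ q y = y'.
Proof.
(* Products act from left to right: the first factor sends [x] to [x'], the second corrects the
   image of [y] while fixing [x']. *)
move=> xy xy'; exists (tperm x x' * tperm (tperm x x' y) y')%g.
rewrite !permM tpermL; split; last by rewrite tpermL.
rewrite tpermD // 1?eq_sym //.
by rewrite -{1}(tpermL x x') (inj_eq perm_inj).
Qed.

(** Double counting of orders together with ordered pairs of distinct active vertices: all
    [n * n.-1] pairs contribute equally, and each order has [l * l.-1] of them. *)
Lemma card_active_pair n l (x y : 'I_n) : l <= n -> x != y ->
  #|[set s : 'S_n | (x \in active s l) && (y \in active s l)]| * (n * n.-1)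
    = n`! * (l * l.-1).
Proof.
move=> ln xy.
pose c u v := #|[set s : 'S_n | (u \in active s l) && (v \in active s l)]|.
have cE u v : u != v -> c u v = c x y.
  move=> uv; have [q [qx qy]] := perm_2transitive uv xy.
  (* Right multiplication by [q] relabels the vertices, carrying the orders counted for [(u, v)] to
     those counted for [(x, y)]. *)
  rewrite /c -(card_imset _ (mulIg q)); apply: eq_card => s; rewrite !inE.
  apply/imsetP/idP => [[s' + ->]|].
    by rewrite inE !mem_active invMg !permM -qx -qy !permK.
  move=> h; exists (s * q^-1)%g; last by rewrite mulgKV.
  by rewrite inE !mem_active invMg invgK !permM qx qy -!mem_active.
have offdiag (A : {set 'I_n}) :
    \sum_(u in A) \sum_(v in A | v != u) 1 = #|A| * #|A|.-1.
  rewrite -sum_nat_const; apply: eq_bigr => u uA.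
  rewrite sum1_card (cardsD1 u A) uA /=.
  by apply: eq_card => v; rewrite !inE andbC.
transitivity (\sum_u \sum_(v | v != u) c u v).
  transitivity (\sum_(u : 'I_n) n.-1 * c x y).
    by rewrite sum_nat_const card_ord mulnC mulnA.
  apply: eq_bigr => u _.
  rewrite (eq_bigr (fun=> c x y)) => [|v vu]; last by rewrite cE // eq_sym.
  rewrite sum_nat_const; congr (_ * _).
  by rewrite (cardC1 u) card_ord.
transitivity (\sum_(s : 'S_n) l * l.-1); last first.
  by rewrite sum_nat_const card_Sn.
under eq_bigr => u _ do under eq_bigr => v _
  do rewrite /c -sum1_card big_mkcond /=.
under eq_bigr => u _ do rewrite exchange_big /=.
rewrite exchange_big /=; apply: eq_bigr => s _.
have := offdiag (active s l); rewrite card_active // => <-.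
rewrite [RHS]big_mkcond /=.
apply: eq_bigr => u _; case: (boolP (u \in _)) => us; last first.
  by rewrite big1 // => v _; rewrite inE (negPf us).
rewrite [RHS]big_mkcondl; apply: eq_bigr => v _.
by rewrite inE us.
Qed.

(** * The expected number of components *)

Lemma sum_CC n (e : rel 'I_n) l : 0 < n -> is_tree e -> l <= n ->
  n * (\sum_(s : 'S_n) CC e s l) = n`! * (l * (n.+1 - l)).
Proof.
case: n e => // n e _ [sg con acyc] ln.
have [p [d pP]] := parent_exists (fun x => con x ord0).
pose up (s : 'S_n.+1) :=
  [set x in active s l | (x != ord0) && (p x \in active s l)].
have CCE s : CC e s l + #|up s| = l.
  by rewrite (n_comp_induced _ sg acyc pP) card_active.
have sum_up : n.+1 * (\sum_s #|up s|) = n.+1`! * (l * l.-1).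
  under eq_bigr => s _ do rewrite -sum1_card big_mkcond /=.
  rewrite exchange_big /= (bigD1 ord0) //= big1 ?add0n => [|s _]; last first.
    by rewrite inE eqxx andbF.
  (* Here [n] is the number of non-root vertices, a factor to be cancelled. With a single vertex
     both sides vanish, since [l <= 1]. *)
  have [n0|n_gt0] := posnP n.
    rewrite big1 => [|x]; first by case: l ln {up CCE} => [|[|l]]; subst; lia.
    by case/eqP; apply/val_inj => /=; case: x => /= m; rewrite n0; lia.
  suff H : \sum_(x : 'I_n.+1 | x != ord0)
      (\sum_s (if x \in up s then 1 else 0)) * (n.+1 * n)
      = n * (n.+1`! * (l * l.-1)).
    apply/eqP; rewrite -(eqn_pmul2l n_gt0) -H -big_distrl /=; apply/eqP; ring.
  rewrite (eq_bigr (fun=> n.+1`! * (l * l.-1))) => [|x x0]; last first.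
    have /andP[exp _] := pP x x0.
    have xp : x != p x by apply/eqP => E; rewrite -E sg.2 in exp.
    rewrite -(card_active_pair ln xp); congr (_ * _).
    rewrite -sum1_card [RHS]big_mkcond /=; apply: eq_bigr => s _.
    by rewrite !inE x0.
  by rewrite sum_nat_const (cardC1 ord0) card_ord.
have : \sum_s CC e s l + \sum_s #|up s| = n.+1`! * l.
  rewrite -big_split /= (eq_bigr (fun=> l)) => [|s _]; last exact: CCE.
  by rewrite sum_nat_const card_Sn.
move: sum_up; set a := \sum_s CC e s l; set b := \sum_s _ => Hb Hab.
apply/eqP; rewrite -(eqn_add2r (n.+1 * b)) -mulnDr Hab Hb.
rewrite mulnCA -mulnDr; apply/eqP; congr (_ * _).
have : l * l.-1 + l = l * l by case: (l) => // m; rewrite mulnS addnC.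
nia.
Qed.

Lemma score_stop_at n (e : rel 'I_n) (l : 'I_n.+1) : 0 < n -> is_tree e ->
  score e (stop_at l) = ((l * (n.+1 - l))%:R / n%:R)%R.
Proof.
move=> n_gt0 he; rewrite /score.
under eq_bigr do rewrite ffunE.
apply/eqP; rewrite eqr_div ?pnatr_eq0 -?lt0n ?fact_gt0 //.
rewrite -natr_sum -!natrM eqr_nat [X in X == _]mulnC [X in _ == X]mulnC.
by rewrite sum_CC // -ltnS.
Qed.

(** * Optimal stopping times and bounds on the maximum *)

Lemma mul_subn_max n l h : l <= n -> (n.+1)./2 <= h <= uphalf n.+1 ->
  l * (n.+1 - l) <= h * (n.+1 - h).
Proof.
move=> ln hh; have [lt_lh|lt_hl|->//] := ltngtP l h.
  (* The right side exceeds the left by [(h - l) * (n.+1 - h - l)], which is nonnegative. *)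
  have -> : n.+1 - l = (n.+1 - h) + (h - l) by lia.
  have : l <= n.+1 - h by lia.
  nia.
have -> : n.+1 - h = (n.+1 - l) + (l - h) by lia.
have : n.+1 - l <= h by lia.
nia.
Qed.

Lemma optimal_stop_at n (e : rel 'I_n) (h : 'I_n.+1) : 0 < n -> is_tree e ->
    (n.+1)./2 <= h <= uphalf n.+1 ->
  optimal_blind e (stop_at h).
Proof.
move=> n_gt0 he hh; split; first by apply/existsP; exists h.
move=> _ /existsP[l /eqP->]; rewrite !score_stop_at //.
rewrite ler_pM2r ?invr_gt0 ?ltr0n // ler_nat.
by apply: mul_subn_max; rewrite // -ltnS.
Qed.

Theorem theorem3p1 (n : nat) (hn : 1 <= n) (e : rel 'I_n) (he : is_tree e) :
  [/\ exists2 l : 'I_n.+1, l = (n.+1)./2 :> nat & optimal_blind e (stop_at l),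
      exists2 l : 'I_n.+1, l = uphalf n.+1 :> nat & optimal_blind e (stop_at l)
    & (n%:R / 4%:R < max_blind e < n%:R / 4%:R + 1)%R].
Proof.
have n0 : (0 < n%:R :> rat)%R by rewrite ltr0n.
split.
- have lt : (n.+1)./2 < n.+1 by lia.
  by exists (Ordinal lt) => //; apply: optimal_stop_at => //=; lia.
- have lt : uphalf n.+1 < n.+1 by lia.
  by exists (Ordinal lt) => //; apply: optimal_stop_at => //=; lia.
apply/andP; split.
  (* At this [l], [4 * l * (n.+1 - l)] is at least [n.+1 ^ 2 - 1], that is [n * (n + 2)], which
     exceeds [n * n]. *)
  have lt : (n.+1)./2 < n.+1 by lia.
  apply: (@lt_le_trans _ _ (score e (stop_at (Ordinal lt)))); last first.
    by apply: le_bigmax_cond; apply/existsP; exists (Ordinal lt).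
  rewrite score_stop_at //= ltr_pdivlMr // mulrAC ltr_pdivrMr //.
  by rewrite -!natrM ltr_nat; nia.
(* By the AM-GM inequality [4 * l * (n.+1 - l) <= n.+1 ^ 2 < n * n + 4 * n]. It holds for every [l],
   so it also covers the default value of the maximum. *)
have bound l : (score e (stop_at l) < n%:R / 4%:R + 1)%R.
  rewrite score_stop_at // ltr_pdivrMr // mulrDl mul1r mulrAC.
  rewrite -[X in (_ + X)%R](mulfK (x := 4%:R)) // -mulrDl ltr_pdivlMr //.
  rewrite -!(natrM, natrD) ltr_nat.
  apply: (@leq_ltn_trans (n.+1 ^ 2)); last by rewrite -mulnn; lia.
  by rewrite mulnC -[X in _ <= X ^ 2](subnKC (ltnW (ltn_ord l))) nat_AGM2.
apply: bigmax_lt => [|_ /existsP[l /eqP->]]; exact: bound.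
Qed.
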